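(* Let $0<\alpha<1$ be irrational, let $T$ be the rotation $Tx=x+\alpha$ modulo $1$ on $[0,1[$ (viewed as a $2$-interval exchange with discontinuity $1-\alpha$), let $N\ge2$, let $0<\zeta_1<1$ and $a_1,a_2\in\mathbb{Z}$, and let $T_f(x,s)=(Tx,s+f(x))$ on $[0,1[\times\mathbb{Z}/N\mathbb{Z}$, where $f(x)=a_1$ for $x\in[0,\zeta_1[$ and $f(x)=a_2$ for $x\in[\zeta_1,1[$. Let $m$ be an integer. Then: (i) if $0<\zeta_1=m\alpha<1$, $T_f$ is minimal if and only if $(N,ma_1,a_2)=1$; (ii) if $0<\zeta_1=1-m\alpha<1$, $T_f$ is minimal if and only if $(N,a_1,ma_2)=1$; (iii) if $0<\zeta_1=m\alpha-m+1<1$, $T_f$ is minimal if and only if $(N,a_1,ma_2)=1$; (iv) if $0<\zeta_1=m-m\alpha<1$, $T_f$ is minimal if and only if $(N,ma_1,a_2)=1$; (v) if $0<\zeta_1=2-m\alpha<1$, $m\ge2$ and $\alpha<\frac1{m-1}$, $T_f$ is minimal if and only if $(N,a_2+(m-2)a_1,ma_1)=1$; (vi) if $0<\zeta_1=m\alpha-1<1$, $m\ge2$ and $\alpha<\frac1{m-1}$, $T_f$ is minimal if and only if $(N,a_1+(m-2)a_2,ma_2)=1$.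
   Context: Intervals are semi-open. The values $a_1,a_2$ of $f$ are reduced modulo $N$. $(x,y,z)$ in conditions such as $(N,ma_1,a_2)=1$ denotes the greatest common divisor, with $0$ divisible by every integer. Minimal means every orbit is dense, $[0,1[\times\{s\}$ carrying the usual interval topology. *)

(* Defs.v *)
From HB Require Import structures.
From mathcomp Require Import all_boot all_order all_algebra.
From mathcomp Require Import all_classical all_reals all_analysis.

Set Implicit Arguments.
Unset Strict Implicit.
Unset Printing Implicit Defensive.

Import Order.TTheory GRing.Theory Num.Theory.
Import numFieldNormedType.Exports.

Local Open Scope classical_set_scope.
Local Open Scope ring_scope.

(* Forward orbit; for the maps below, all forward orbits are dense if and only
   if all two-sided orbits are. *)
Definition orbit (X : Type) (F : X -> X) (x : X) : set X :=
  range (fun n : nat => iter n F x).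

Definition minimal (X : topologicalType) (F : X -> X) : Prop :=
  forall x : X, dense (orbit F x).

(* A set_type carries the topology induced by the inclusion in R. *)
Definition unit_itv (R : realType) : topologicalType :=
  set_type (`[0, 1[%classic : set R).

(* 'Z_N is Z/NZ only for 1 < N. In the product topology each
   copy [0, 1[ x {s} is open and carries its usual topology. *)
Definition ext_space (R : realType) (N : nat) : topologicalType :=
  (unit_itv R * discrete_topology 'Z_N)%type.

Definition fract (R : realType) (x : R) : R := x - (Num.floor x)%:~R.

Lemma fract_itv (R : realType) (x : R) :
  fract x \in (`[0, 1[%classic : set R).
Proof.
rewrite inE /= in_itv /= /fract subr_ge0 floor_le /=.
by rewrite ltrBlDl -intrD1 floorD1_gt.
Qed.

Definition rotation (R : realType) (alpha : R) (x : unit_itv R) : unit_itv R :=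
  SigSub (fract_itv (set_val x + alpha)).

Definition step_cocycle (R : realType) (N : nat) (zeta : R) (a1 a2 : int)
    (x : unit_itv R) : 'Z_N :=
  if set_val x < zeta then a1%:~R else a2%:~R.

Definition rotation_ext (R : realType) (N : nat) (alpha zeta : R) (a1 a2 : int)
    (p : ext_space R N) : ext_space R N :=
  (rotation alpha p.1, (p.2 : 'Z_N) + step_cocycle N zeta a1 a2 p.1).

(* gcdz x 0 = `|x|, so 0 is divisible by every integer. *)
Definition gcd3 (x y z : int) : int := gcdz x (gcdz y z).

(* Main.v *)
Require Import Defs.
From mathcomp Require Import all_boot all_order all_algebra.
From mathcomp Require Import all_classical all_reals all_analysis.
From mathcomp Require Import ring lra.
Import Order.TTheory GRing.Theory Num.Theory.
Import numFieldNormedType.Exports.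
Local Open Scope ring_scope.

(** In each of the six cases zeta1 = p alpha + q for some integers p and q, and
    this is all that matters. For a real y, the indicator of [0, zeta1[ at the
    fractional part of y is floor y - floor (y - zeta1), that is,
    floor y - floor (y - p alpha) + q. The difference of the two floors
    telescopes along the rotation: it equals phi (y + alpha) - phi y for an
    integer step function phi with phi (y + k) = phi y + k p
    (floor_transfer). Hence, if the orbit of x makes k turns in time n and
    ends at x' = x + n alpha - k, the second coordinate increases by

      n A + k B + (a1 - a2) (phi x' - phi x),

    where A = a2 + q (a1 - a2) and B = p (a1 - a2).

    As phi is locally constant on the right, the last term is fixed as soon as x'
    stays in a suitable short interval. Inside such an interval, n and k still
    take all pairs of values modulo N, because alpha is irrational
    (orbit_dense_mod_congruence). So the values of the second coordinate met
    there form a coset of the subgroup of Z/NZ generated by A and B, and T_f is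
    minimal if and only if gcd (N, A, B) = 1 (rotation_ext_minimal).

    In each case elementary operations on the pair (A, B) give the stated gcd. *)

Local Open Scope classical_set_scope.

(** * Arithmetic in Z/NZ *)

Lemma intr_Zp_eq0 (N : nat) (hN : (1 < N)%N) (z : int) :
  (z%:~R == 0 :> 'Z_N) = (N %| z)%Z.
Proof.
have NZ : (N%:Z)%:~R = 0 :> 'Z_N by rewrite -pmulrn pchar_Zp.
rewrite [z in LHS](divz_eq z N) intrD intrM NZ mulr0 add0r.
have : 0 <= (z %% N)%Z by rewrite modz_ge0// -lt0n ltnW.
case E : (z %% N)%Z => [r|//] _.
rewrite -pmulrn -val_eqE /= val_Zp_nat// (sameP dvdz_mod0P eqP) E.
have : (r < N)%N by rewrite -ltz_nat -E ltz_pmod// ltz_nat ltnW.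
by move=> /modn_small ->.
Qed.

Lemma gcd3_eq1P (N A B : int) :
  gcd3 N A B = 1 <-> exists u v, (N %| u * A + v * B - 1)%Z.
Proof.
rewrite /gcd3; split => [h|[u [v h]]].
  have [u [v uv]] := Bezoutz N (gcdz A B).
  have [u' [v' uv']] := Bezoutz A B.
  exists (v * u'), (v * v'); apply/dvdzP; exists (- u).
  by rewrite -h -uv -uv'; ring.
set g := gcdz N _.
have g1 : (g %| 1)%Z.
  have gN : (g %| N)%Z by exact: dvdz_gcdl.
  have gA : (g %| A)%Z by apply: dvdz_trans (dvdz_gcdr _ _) (dvdz_gcdl _ _).
  have gB : (g %| B)%Z by apply: dvdz_trans (dvdz_gcdr _ _) (dvdz_gcdr _ _).
  have -> : 1 = u * A + v * B - (u * A + v * B - 1) :> int by ring.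
  by apply: rpredB; [apply: rpredD; exact: dvdz_mull|exact: dvdz_trans h].
by move: g1; rewrite dvdzE dvdn1 /g /gcdz absz_nat => /eqP ->.
Qed.

(** * Density of orbits of an irrational rotation *)

(** Dirichlet's argument: two of the first points of the orbit of 0 lie in one
    small cell, and irrationality keeps them distinct. *)
Lemma small_return (R : realType) (alpha e : R) :
  irrational alpha -> 0 < e ->
  exists (n : nat) (k : int), 0 < `|n%:R * alpha - k%:~R| < e.
Proof.
move=> hirr e0.
pose M := (Num.truncn e^-1).+1.
have M0 : 0 < M%:R :> R by rewrite ltr0n.
have Me : M%:R^-1 < e.
  by rewrite invf_plt ?posrE// /M truncnS_gt.
pose fr (i : nat) := fract (i%:R * alpha).
have fr01 i : 0 <= fr i < 1.
  by have := fract_itv (i%:R * alpha); rewrite inE /= in_itv.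
pose cell (i : nat) := `|Num.floor (M%:R * fr i)|%N.
have cellE i : (cell i)%:Z = Num.floor (M%:R * fr i).
  have /andP[h _] := fr01 i.
  by rewrite /cell gez0_abs// floor_ge0 mulr_ge0// ltW.
have cell_bounds i : (cell i)%:R <= M%:R * fr i < (cell i)%:R + 1.
  by rewrite !pmulrn cellE floor_le -intrD1 floorD1_gt.
(* Pigeonhole: M + 1 points fall into M cells of length 1 / M. *)
have : ~ {in `I_M.+1 &, injective cell}.
  move=> /pigeonhole -/(_ M) H.
  have : (M.+1 <= M)%N; last by rewrite ltnn.
  apply: H => _ [i _ <-] /=.
  have /andP[_ h] := fr01 i; have /andP[h1 _] := cell_bounds i.
  rewrite -(ltr_nat R); apply: le_lt_trans h1 _.
  by rewrite -[ltRHS]mulr1 ltr_pM2l.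
move=> H.
have [i [j [ij cij]]] : exists i j, (i < j)%N /\ cell i = cell j.
  apply: contrapT => H'; apply: H => i j _ _ cij.
  by case: (ltngtP i j) => // ij; exfalso; apply: H'; [exists i, j|exists j, i].
exists (j - i)%N, (Num.floor (j%:R * alpha) - Num.floor (i%:R * alpha)).
have -> : (j - i)%:R * alpha
    - (Num.floor (j%:R * alpha) - Num.floor (i%:R * alpha))%:~R = fr j - fr i.
  by rewrite natrB 1?ltnW// intrB /fr /fract; ring.
apply/andP; split.
  rewrite normr_gt0; apply/eqP => fij; apply: hirr.
  exists ((Num.floor (j%:R * alpha) - Num.floor (i%:R * alpha))%:~R
      / (j - i)%:R) => //.
  rewrite fmorph_div/= ratr_int ratr_nat.
  have n0 : (j - i)%:R != 0 :> R by rewrite pnatr_eq0 -lt0n subn_gt0.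
  apply: (mulIf n0); rewrite divfK// [RHS]mulrC.
  move: fij; rewrite natrB 1?ltnW// intrB /fr /fract; lra.
have /andP[bi1 bi2] := cell_bounds i; have /andP[bj1 bj2] := cell_bounds j.
rewrite cij in bi1 bi2; apply: lt_trans Me.
rewrite -(ltr_pM2l M0) mulfV ?gt_eqF// -{1}(gtr0_norm M0) -normrM ltr_norml.
by apply/andP; split; lra.
Qed.

(** Multiples of a small return d cannot jump over an interval longer than |d|.
    As n must be nonnegative, the walk can only go in the direction of the sign
    of d; the integer from which it starts is chosen accordingly. *)
Lemma orbit_dense_mod1 (R : realType) (alpha l r : R) :
  irrational alpha -> l < r ->
  exists (n : nat) (k : int), l < n%:R * alpha + k%:~R < r.
Proof.
move=> hirr lr.
have [n [k /andP[d0 d1]]] : exists (n : nat) (k : int),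
  0 < `|n%:R * alpha - k%:~R| < r - l by apply: small_return; rewrite ?subr_gt0.
set d := _ - _ in d0 d1.
suff [j [K jK]] : exists (j : nat) (K : int), l < j%:R * d + K%:~R < r.
  exists (j * n)%N, (K - j%:Z * k).
  suff -> : (j * n)%:R * alpha + (K - j%:Z * k)%:~R = j%:R * d + K%:~R by [].
  by rewrite natrM intrB intrM -pmulrn /d; ring.
move: d0; rewrite normr_gt0 neq_lt => /orP[dn|dp].
  rewrite ltr0_norm// in d1.
  (* Steps are negative: start from an integer to the right of the interval. *)
  pose K := Num.floor r + 1.
  have rK : r < K%:~R by exact: floorD1_gt.
  pose j := Num.truncn ((K%:~R - r) / - d).
  have h0 : 0 <= (K%:~R - r) / - d.
    by apply: divr_ge0; rewrite ?subr_ge0 ?oppr_ge0 ltW.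
  have /andP[h1 h2] := truncn_itv h0.
  exists j.+1, K.
  rewrite -/j ler_pdivlMr ?oppr_gt0// in h1.
  rewrite -/j ltr_pdivrMr ?oppr_gt0// in h2.
  rewrite -natr1 in h2 *; apply/andP; split; lra.
rewrite gtr0_norm// in d1.
pose K := Num.floor l.
have lK : K%:~R <= l by exact: floor_le.
pose j := Num.truncn ((l - K%:~R) / d).
have h0 : 0 <= (l - K%:~R) / d.
  by apply: divr_ge0; [rewrite subr_ge0|exact: ltW].
have /andP[h1 h2] := truncn_itv h0.
exists j.+1, K.
rewrite -/j ler_pdivlMr// in h1.
rewrite -/j ltr_pdivrMr// in h2.
rewrite -natr1 in h2 *; apply/andP; split; lra.
Qed.

(** This is the source of minimality: the time n and the number k of turns can be
    prescribed modulo N at once. Writing n = u + N n' and k = v + N k', the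
    position is a constant plus N (n' alpha - k'), to which the density of the
    orbit of 0 modulo 1 applies. *)
Lemma orbit_dense_mod_congruence (R : realType) (alpha : R) (N : nat)
    (u v : int) (l r : R) : irrational alpha -> (0 < N)%N -> l < r ->
  exists (n : nat) (k : int),
    [/\ (N %| n%:Z - u)%Z, (N %| k - v)%Z
      & l < n%:R * alpha - k%:~R < r].
Proof.
move=> hirr N0 lr.
have NR0 : 0 < N%:R :> R by rewrite ltr0n.
pose u' := `|(u %% N)%Z|%N.
have u'E : u'%:Z = (u %% N)%Z by rewrite /u' gez0_abs// modz_ge0 // -lt0n.
pose c := u'%:R * alpha - v%:~R.
have [|n [k /andP[h1 h2]]] :=
  @orbit_dense_mod1 R alpha ((l - c) / N%:R) ((r - c) / N%:R) hirr.
  by rewrite ltr_pM2r ?invr_gt0// ltrD2r.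
rewrite ltr_pdivrMr// in h1; rewrite ltr_pdivlMr// in h2.
exists (u' + n * N)%N, (v - k * N); split.
- apply/dvdzP; exists (n%:Z - (u %/ N)%Z).
  by rewrite PoszD PoszM u'E {2}(divz_eq u N); ring.
- by apply/dvdzP; exists (- k); ring.
- rewrite natrD natrM intrB intrM -pmulrn.
  by apply/andP; split; move: h1 h2; rewrite /c; lra.
Qed.

(** * The transfer function *)

Lemma floor_right_locally_constant (R : realType) (c y : R) :
  \forall z \near y^'+, Num.floor (z - c) = Num.floor (y - c).
Proof.
near=> z; apply: floor_def; apply/andP; split.
  apply: le_trans (floor_le _) _; rewrite lerD2r; near: z.
  exact: nbhs_right_ge.
rewrite ltrBlDr; near: z; apply: nbhs_right_lt.
by rewrite -ltrBlDr floorD1_gt.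
Unshelve. all: by end_near. Qed.

(** The indicator of an interval of length p alpha + q is a coboundary up to
    constants, and phi is the transfer function. For p >= 0 it is
    y |-> \sum_(1 <= i <= p) floor (y - i alpha), and the difference between
    y + alpha and y telescopes; the induction on p covers both signs. Working on
    the real line instead of the circle turns the number of turns into the term
    k p of the first property. *)
Lemma floor_transfer (R : realType) (alpha : R) (p : int) :
  exists phi : R -> int,
  [/\ forall y k, phi (y + k%:~R) = phi y + k * p,
      forall y, phi (y + alpha) - phi y
                = Num.floor y - Num.floor (y - p%:~R * alpha)
    & forall y, \forall z \near y^'+, phi z = phi y].
Proof.
elim: p => [|n [phi [phi_shift phi_step phi_loc]]
            |n [phi [phi_shift phi_step phi_loc]]].
- exists (fun=> 0); split => [y k|y|y]; first by rewrite mulr0.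
  + by rewrite mul0r !subr0 subrr.
  + exact: nearW.
- exists (fun y => phi y + Num.floor (y - n.+1%:R * alpha)); split => [y k|y|y].
  + rewrite phi_shift [y + _ - _]addrAC floorDrz ?intr_int// intrKfloor intS.
    ring.
  + have -> : y + alpha - n.+1%:R * alpha = y - n%:~R * alpha.
      by rewrite -natr1 -pmulrn; ring.
    by move: (phi_step y); rewrite -!pmulrn; lra.
  + near=> z; congr (_ + _); first by near: z; exact: phi_loc.
    by near: z; exact: floor_right_locally_constant.
- exists (fun y => phi y - Num.floor (y - - n%:R * alpha)); split => [y k|y|y].
  + rewrite phi_shift [y + _ - _]addrAC floorDrz ?intr_int// intrKfloor intS.
    ring.
  + have -> : y + alpha - - n%:R * alpha = y - (- n.+1%:Z)%:~R * alpha.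
      by rewrite intrN -pmulrn -natr1; ring.
    by move: (phi_step y); rewrite intrN -!pmulrn; lra.
  + near=> z; congr (_ - _); first by near: z; exact: phi_loc.
    by near: z; exact: floor_right_locally_constant.
Unshelve. all: by end_near. Qed.

(** * Iterates of the skew product *)

Lemma unit_itv_bounds (R : realType) (x : unit_itv R) : 0 <= set_val x < 1.
Proof. by have := set_valP x; rewrite /= in_itv. Qed.

(** On the lift y of a point, the indicator of [0, zeta[ is
    floor y - floor (y - zeta), and zeta = p alpha + q. *)
Lemma step_cocycle_fract (R : realType) (alpha zeta : R) (N : nat)
    (a1 a2 p q : int) (phi : R -> int) :
  zeta = p%:~R * alpha + q%:~R -> 0 < zeta < 1 ->
  (forall y, phi (y + alpha) - phi y
             = Num.floor y - Num.floor (y - p%:~R * alpha)) ->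
  forall y : R,
  step_cocycle N zeta a1 a2 (SigSub (fract_itv y))
  = (a2 + (a1 - a2) * (phi (y + alpha) - phi y + q))%:~R.
Proof.
move=> zetaE zeta01 phi_step y.
have -> : phi (y + alpha) - phi y + q = Num.floor y - Num.floor (y - zeta).
  have -> : y - zeta = y - p%:~R * alpha + (- q)%:~R.
    by rewrite zetaE intrN; ring.
  by rewrite floorDrz ?intr_int// intrKfloor phi_step; ring.
have /andP[fy fy1] := floor_itv y; have /andP[z0 z1] := zeta01.
rewrite intrD in fy1.
rewrite /step_cocycle -[set_val _]/(fract y) /fract; case: ltP => h.
  have -> : Num.floor (y - zeta) = Num.floor y - 1.
    by apply: floor_def; rewrite subrK intrB; apply/andP; split; lra.
  by congr (_ %:~R); ring.
have -> : Num.floor (y - zeta) = Num.floor y.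
  by apply: floor_def; rewrite intrD; apply/andP; split; lra.
by rewrite subrr mulr0 addr0.
Qed.

Lemma iter_rotation_ext (R : realType) (alpha zeta : R) (N : nat)
    (a1 a2 p q : int) (phi : R -> int) :
  zeta = p%:~R * alpha + q%:~R -> 0 < zeta < 1 ->
  (forall y, phi (y + alpha) - phi y
             = Num.floor y - Num.floor (y - p%:~R * alpha)) ->
  forall (x : unit_itv R) (s : 'Z_N) (n : nat),
  let y : R := set_val x + n%:R * alpha in
  iter n (@rotation_ext R N alpha zeta a1 a2) (x, s) =
  (SigSub (fract_itv y),
   s + (n%:Z * (a2 + q * (a1 - a2))
        + (a1 - a2) * (phi y - phi (set_val x)))%:~R).
Proof.
move=> zetaE zeta01 phi_step x s n.
elim: n => [|n IH] /=.
  rewrite mul0r !addr0 subrr mulr0 mul0r !addr0; congr (_, _).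
  apply: val_inj => /=.
  have /andP[x0 x1] := unit_itv_bounds _ x.
  rewrite /fract (floor_def (m := 0)) ?subr0//.
  by rewrite x0.
rewrite IH /rotation_ext /=; set y := _ + n%:R * alpha.
have -> : set_val x + n.+1%:R * alpha = y + alpha by rewrite -natr1 /y; ring.
congr (_, _).
  apply: val_inj.
  rewrite -[LHS]/(fract (fract y + alpha)) -[RHS]/(fract _) /fract.
  have -> : y - (Num.floor y)%:~R + alpha = y + alpha + (- Num.floor y)%:~R.
    by rewrite intrN; ring.
  by rewrite [Num.floor (_ + _%:~R)]floorDrz ?intr_int// intrKfloor intrD; ring.
rewrite (step_cocycle_fract _ _ _ _ _ _ _ _ _ zetaE zeta01 phi_step).
rewrite -addrA -intrD; congr (_ + _%:~R).
rewrite intS; ring.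
Qed.

(** * Topology of the phase space *)

(** Only the right of y matters: the transfer function may jump when y is
    approached from the left. *)
Lemma nbhs_ext_space (R : realType) (N : nat) (O : set (ext_space R N))
    (y : unit_itv R) (t : 'Z_N) :
  open O -> O (y, t) ->
  \forall z \near (set_val y)^'+,
    forall x : unit_itv R, set_val x = z -> O (x, t).
Proof.
move=> oO Oyt.
have : nbhs ((y, t) : ext_space R N) O by exact: open_nbhs_nbhs.
move=> -[[U V] /= [nU nV] UV].
have [_ [[B oB <-] By BU]] := nU.
have nB : \forall z \near (set_val y)^'+, B z.
  have nB : nbhs (set_val y) B by exact: open_nbhs_nbhs.
  exact: (cvg_within _ nB).
near=> z => x xz; apply: UV; split => /=; last exact: (nbhs_singleton nV).
apply: BU => /=; rewrite xz; near: z.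
Unshelve. all: by end_near. Qed.

Lemma open_ext_space (R : realType) (N : nat) (B : set R) (t : 'Z_N) :
  open B -> open ([set p : ext_space R N | B (set_val p.1) /\ p.2 = t]).
Proof.
move=> oB; rewrite openE => -[y s] /= [By ->].
exists (set_val @^-1` B, [set t]) => /=; last by move=> [? ?].
split; last exact: discrete_set1.
by apply: open_nbhs_nbhs; split => //; exists B.
Qed.

(** * Minimality *)

(** The six cases differ only in the integers p and q: up to the coboundary of
    phi, after time n and k turns the second coordinate has moved by n A + k B,
    with A and B the two last arguments of gcd3. *)
Lemma rotation_ext_minimal (R : realType) (alpha zeta : R) (N : nat)
    (a1 a2 p q : int) :
  irrational alpha -> (1 < N)%N -> 0 < zeta < 1 ->
  zeta = p%:~R * alpha + q%:~R ->
  minimal (@rotation_ext R N alpha zeta a1 a2) <->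
  gcd3 N (a2 + q * (a1 - a2)) (p * (a1 - a2)) = 1.
Proof.
move=> hirr hN zeta01 zetaE; set A := a2 + _; set B := p * _.
have [phi [phi_shift phi_step phi_loc]] := @floor_transfer R alpha p.
have iterE :=
  @iter_rotation_ext R alpha zeta N a1 a2 p q phi zetaE zeta01 phi_step.
rewrite gcd3_eq1P; split.
  (* Start at (0, 0) and aim at [0, e[ x {1}: phi takes the same value at both
     ends, so the coboundary cancels and 1 is a combination of A and B. *)
  pose x0 : unit_itv R := SigSub (fract_itv 0).
  have x00 : set_val x0 = 0 by rewrite -[LHS]/(fract 0) /fract floor0 subr0.
  move=> /(_ (x0, 0)) dn.
  have [e /= e0 phi_e] := phi_loc 0.
  have [|[y s] /= [[/= ye s1] [n _]]] :=
      dn _ _ (@open_ext_space R N [set z | z < e] 1 (@open_lt R e)).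
    by exists (x0, 1); split => //=; rewrite x00.
  rewrite iterE x00 add0r => -[yE sE].
  have {}yE : set_val y = fract (n%:R * alpha) by rewrite -yE.
  have phi_n : phi (n%:R * alpha) = phi 0 + Num.floor (n%:R * alpha) * p.
    have nE : n%:R * alpha = set_val y + (Num.floor (n%:R * alpha))%:~R.
      by rewrite yE /fract subrK.
    rewrite {1}nE phi_shift; congr (_ + _).
    have /andP[+ _] := unit_itv_bounds _ y.
    rewrite le_eqVlt => /orP[/eqP <- //|y0].
    by apply: phi_e => //=; rewrite sub0r normrN gtr0_norm.
  exists n, (Num.floor (n%:R * alpha)).
  rewrite -intr_Zp_eq0// intrB subr_eq0 -[1%:~R]s1 -sE add0r phi_n.
  by apply/eqP; congr _%:~R; rewrite /A /B; ring.
move=> [u [v uv]] [x s] O [[y t] Oyt] oO.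
pose c := a1 - a2.
(* T is what must be added to the second coordinate once the coboundary has
   been accounted for; n = u T and k = v T modulo N produce it. *)
pose T : int :=
  (t : nat)%:Z - (s : nat)%:Z - c * (phi (set_val y) - phi (set_val x)).
have [e /= e0 He] : \forall z \near (set_val y)^'+,
    [/\ z < 1, phi z = phi (set_val y)
      & forall x : unit_itv R, set_val x = z -> O (x, t)].
  near=> z; split; near: z; last exact: nbhs_ext_space.
    apply: nbhs_right_lt.
    by have /andP[] := unit_itv_bounds _ y.
  exact: phi_loc.
have [|n [k [nu kv /andP[lo hi]]]] :=
  @orbit_dense_mod_congruence R alpha N (u * T) (v * T)
    (set_val y - set_val x) (set_val y - set_val x + e) hirr (ltnW hN).
  by rewrite ltrDl.
pose z := set_val x + n%:R * alpha - k%:~R.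
have yz : set_val y < z by rewrite /z; lra.
have [z1 phiz Oz] : [/\ z < 1, phi z = phi (set_val y)
    & forall x : unit_itv R, set_val x = z -> O (x, t)].
  by apply: He => //=; rewrite ltr0_norm /z; lra.
have /andP[y0 _] := unit_itv_bounds _ y.
have zk : set_val x + n%:R * alpha = z + k%:~R by rewrite /z subrK.
exists (iter n (@rotation_ext R N alpha zeta a1 a2) (x, s)).
split; last by exists n.
rewrite iterE zk phi_shift phiz.
set w := SigSub _; have wz : set_val w = z.
  rewrite -[LHS]/(fract (z + k%:~R)) /fract floorDrz ?intr_int// intrKfloor.
  have -> : Num.floor z = 0 by apply: floor_def; apply/andP; split; lra.
  by rewrite add0r addrK.
set s' := s + _; suff -> : s' = t by exact: Oz.
apply/eqP; rewrite /s' -{1}[s]natr_Zp -[t]natr_Zp !pmulrn.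
rewrite -intrD -subr_eq0 -intrB.
rewrite intr_Zp_eq0//.
move: nu kv uv => /dvdzP[i iE] /dvdzP[j jE] /dvdzP[l lE].
apply/dvdzP; exists (i * A + j * B + l * T).
have nE : n%:Z = u * T + i * N by rewrite -iE; ring.
have kE : k = v * T + j * N by rewrite -jE; ring.
have BE : B = p * c by [].
have AE : A = a2 + q * c by [].
rewrite -/c -AE nE kE.
transitivity ((u * A + v * B - 1) * T + (i * A + j * B) * N).
  by rewrite /T BE; ring.
by rewrite lE; ring.
Unshelve. all: by end_near. Qed.

Local Close Scope classical_set_scope.

Theorem theorem11 (R : realType) (alpha : R) (N : nat) (zeta1 : R)
    (a1 a2 m : int)
    (halpha : 0 < alpha < 1) (hirr : @irrational R alpha)
    (hN : (2 <= N)%N) (hzeta : 0 < zeta1 < 1) :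
  let Tf := @rotation_ext R N alpha zeta1 a1 a2 in
  (zeta1 = m%:~R * alpha ->
    (minimal Tf <-> gcd3 N%:Z (m * a1) a2 = 1)) /\
  (zeta1 = 1 - m%:~R * alpha ->
    (minimal Tf <-> gcd3 N%:Z a1 (m * a2) = 1)) /\
  (zeta1 = m%:~R * alpha - m%:~R + 1 ->
    (minimal Tf <-> gcd3 N%:Z a1 (m * a2) = 1)) /\
  (zeta1 = m%:~R - m%:~R * alpha ->
    (minimal Tf <-> gcd3 N%:Z (m * a1) a2 = 1)) /\
  (zeta1 = 2 - m%:~R * alpha -> 2 <= m -> alpha < 1 / (m%:~R - 1) ->
    (minimal Tf <-> gcd3 N%:Z (a2 + (m - 2) * a1) (m * a1) = 1)) /\
  (zeta1 = m%:~R * alpha - 1 -> 2 <= m -> alpha < 1 / (m%:~R - 1) ->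
    (minimal Tf <-> gcd3 N%:Z (a1 + (m - 2) * a2) (m * a2) = 1)).
Proof.
move=> Tf.
have minE p q : zeta1 = p%:~R * alpha + q%:~R ->
    minimal Tf <-> gcd3 N%:Z (a2 + q * (a1 - a2)) (p * (a1 - a2)) = 1.
  by move=> h; exact: rotation_ext_minimal.
rewrite /gcd3 in minE *.
split=> [h|]; last split=> [h|]; last split=> [h|]; last split=> [h|];
  last split=> [h _ _|h _ _].
- rewrite (minE m 0) ?h; last by ring.
  have -> : a2 + 0 * (a1 - a2) = a2 by ring.
  have -> : m * (a1 - a2) = - m * a2 + m * a1 by ring.
  by rewrite gcdzMDl (gcdzC a2).
- rewrite (minE (- m) 1) ?h ?intrN; last by ring.
  have -> : a2 + 1 * (a1 - a2) = a1 by ring.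
  have -> : - m * (a1 - a2) = - m * a1 + m * a2 by ring.
  by rewrite gcdzMDl.
- rewrite (minE m (1 - m)) ?h ?intrB; last by ring.
  have -> : a2 + (1 - m) * (a1 - a2) = -1 * (m * (a1 - a2)) + a1 by ring.
  have -> : m * (a1 - a2) = m * a1 + - (m * a2) by ring.
  by rewrite (gcdzC (_ + a1)) gcdzMDl (gcdzC _ a1) gcdzMDl gcdzN.
- rewrite (minE (- m) m) ?h ?intrN; last by ring.
  have -> : a2 + m * (a1 - a2) = -1 * (- m * (a1 - a2)) + a2 by ring.
  have -> : - m * (a1 - a2) = m * a2 + - (m * a1) by ring.
  by rewrite (gcdzC (_ + a2)) gcdzMDl (gcdzC _ a2) gcdzMDl gcdzN (gcdzC a2).
- rewrite (minE (- m) 2) ?h ?intrN; last by ring.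
  have -> : - m * (a1 - a2) = - m * (a2 + 2 * (a1 - a2)) + m * a1 by ring.
  rewrite gcdzMDl.
  have -> : a2 + 2 * (a1 - a2) = 1 * (m * a1) + - (a2 + (m - 2) * a1) by ring.
  by rewrite (gcdzC _ (m * a1)) gcdzMDl gcdzN (gcdzC (m * a1)).
- rewrite (minE m (-1)) ?h ?intrN; last by ring.
  have -> : m * (a1 - a2) = - m * (a2 + -1 * (a1 - a2)) + m * a2 by ring.
  rewrite gcdzMDl.
  have -> : a2 + -1 * (a1 - a2) = 1 * (m * a2) + - (a1 + (m - 2) * a2) by ring.
  by rewrite (gcdzC _ (m * a2)) gcdzMDl gcdzN (gcdzC (m * a2)).
Qed.
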